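(* Let $I\subseteq\mathbb{R}\setminus\{0\}$ be an interval, let $f:I\to\mathbb{R}$ be differentiable on the interior $I^{\circ}$ of $I$, let $a,b\in I$ with $a\le b$, and let $h:[a,b]\to[0,\infty)$ be differentiable. If $f'\in L[a,b]$, then the following identity holds: $$\left[h(b)-2h(a)\right]\frac{f(a)}{2}+h(b)\frac{f(b)}{2}-\int_a^b f(x)h'(x)\,dx$$ $$=\frac{b-a}{4ab}\left\{\int_0^1\left[2h(L(t))-h(b)\right]f'(L(t))\,(L(t))^2\,dt+\int_0^1\left[2h(U(t))-h(b)\right]f'(U(t))\,(U(t))^2\,dt\right\}.$$
   Context: Notation: $H=H(a,b)=\frac{2ab}{a+b}$, and for $t\in[0,1]$, $L(t)=\frac{aH}{tH+(1-t)a}$ and $U(t)=\frac{bH}{tH+(1-t)b}$. $L[a,b]$ denotes the set of integrable functions on $[a,b]$.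
   Formalization: Added: f is continuous on [a,b] (otherwise false: I=[1,2], f(1)=1, f=0 elsewhere, h=1 gives −1/2=0; automatic if a,b are interior to I), and f·h' is Lebesgue integrable on [a,b], so that the integral on the left exists. *)

(* Defs.v *)
From HB Require Import structures.
From mathcomp Require Export all_boot all_order all_algebra.
From mathcomp Require Export all_classical all_reals all_analysis.
Export Order.TTheory GRing.Theory Num.Theory.
Export numFieldNormedType.Exports.

Set Implicit Arguments.
Unset Strict Implicit.
Unset Printing Implicit Defensive.

Local Open Scope classical_set_scope.
Local Open Scope ring_scope.

(* A function on D is encoded as a total function [R -> R] of which only the
   values on D matter.  The library's [derivable] and [f^`()] at x see values
   of f on both sides of x, hence the following versions relative to D, which
   at the endpoints of D = `[a, b] are the one-sided ones. *)
Definition derivable_within (R : realType) (D : set R) (f : R -> R) (x : R) :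
    Prop :=
  cvg ((f y - f x) / (y - x) @[y --> within D x^']).

Definition derive_within (R : realType) (D : set R) (f : R -> R) (x : R) : R :=
  lim ((f y - f x) / (y - x) @[y --> within D x^']).

Definition harm (R : realType) (a b : R) : R := 2 * a * b / (a + b).

Definition Lpath (R : realType) (a b t : R) : R :=
  a * harm a b / (t * harm a b + (1 - t) * a).

Definition Upath (R : realType) (a b t : R) : R :=
  b * harm a b / (t * harm a b + (1 - t) * b).

(* Main.v *)
From HB Require Import structures.
Require Import Defs.
From mathcomp Require Import measurable_realfun lra ring.

(** The paths L and U satisfy L' = - c L^2 and U' = c U^2 with
    c = (b - a) / (2ab), and run from H to a and from H to b.  Substituting
    them, the right-hand side becomes half of the integral over [a, b] of
    (2h - h(b)) f', and integrating h f' by parts gives the left-hand side.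

    Since f' and f h' are merely Lebesgue integrable, this needs the
    fundamental theorem of calculus for an everywhere differentiable function F
    with integrable derivative.  For F' >= 0, the Vitali-Caratheodory theorem
    yields a lower semicontinuous u > F' with integral at most that of F' plus
    e; as u stays above F'(x) near x, the increments of F are bounded by the
    integrals of u.  A derivative that is not bounded below is replaced by
    max(F', -n), and applying the inequality to F and - F gives the equality.
    The substitution rule for integrable functions follows by checking that the
    measure with density phi', pushed forward by phi, is Lebesgue measure on
    rays. *)

Local Open Scope classical_set_scope.
Local Open Scope ring_scope.

(** * Fundamental theorem of calculus for integrable derivatives *)

Section VitaliCaratheodory.
Context {R : realType}.
Notation mu := (@lebesgue_measure R).
Local Open Scope ereal_scope.

(** If the sum exceeds [a] at [x], so does some partial sum [S n]. Each term is constant on its open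
    set and takes its least value, zero, elsewhere, so a finite sum does not drop near [x]; the tail
    is nonnegative. *)
Lemma lower_semicontinuous_series_indic (c : R^nat) (V : (set R)^nat) :
  (forall k, (0 <= c k)%R) -> (forall k, open (V k)) ->
  lower_semicontinuous (fun x : R => \sum_(k <oo) (c k * \1_(V k) x)%:E).
Proof.
move=> c0 oV x a.
have u0 y k : 0 <= (c k * \1_(V k) y)%:E by rewrite lee_fin mulr_ge0.
pose S n y := \sum_(0 <= k < n) (c k * \1_(V k) y)%:E.
move=> ax; have [n an] : exists n, a%:E < S n x.
  apply: contrapT => /forallNP Sa; move: ax; rewrite ltNge => /negP; apply.
  apply: lime_le; first exact: is_cvg_nneseries.
  by apply: nearW => n; rewrite leNgt; apply/negP/Sa.
exists [set y | S n x <= S n y]; last first.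
  by move=> y /(lt_le_trans an)/lt_le_trans; apply; exact: nneseries_lim_ge.
suff : \forall y \near x, S n x <= S n y by [].
rewrite /S; elim: n {an} => [|n IHn]; first by near=> y; rewrite !big_geq.
have : \forall y \near x, (c n * \1_(V n) x <= c n * \1_(V n) y)%R.
  have [Ox|nOx] := pselect (V n x).
    have := open_nbhs_nbhs (conj (oV n) Ox); apply: filterS => y Oy.
    by rewrite !indicE !mem_set.
  by near=> y; rewrite !indicE memNset// mulr0 mulr_ge0.
apply: filterS2 IHn => y Sy cy /=.
by rewrite !big_nat_recr//= leeD// lee_fin.
Unshelve. all: by end_near. Qed.

(** The Vitali-Caratheodory majorant of a nonnegative function. Slicing the values of [g] into steps
    of height [d] costs at most [d * mu D], enlarging the slices to open sets costs a summable
    error, and each is held to [e / 2]. Rounding up to the excluded upper end of a slice makes the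
    majorant strict. *)
Lemma ge0_lower_semicontinuous_majorant (D : set R) (g : R -> R) (e : R) :
  measurable D -> mu D < +oo -> measurable_fun D g ->
  (forall x, D x -> (0 <= g x)%R) -> (0 < e)%R ->
  exists u : R -> \bar R, [/\ lower_semicontinuous u, forall x, 0 <= u x,
    forall x, D x -> (g x)%:E < u x &
    \int[mu]_(x in D) u x <= \int[mu]_(x in D) (g x)%:E + e%:E].
Proof.
move=> mD Dfin mg g0 e0.
pose m := fine (mu D).
have muD : mu D = m%:E by rewrite fineK// ge0_fin_numE.
have m0 : (0 <= m)%R by rewrite fine_ge0.
(* The final estimate needs [d * m <= e / 2]; dividing by [m + 1] rather than [m] keeps [d] positive
   when [D] is null. *)
pose d := (e / 2 / (m + 1))%R.
have m1 : (0 < m + 1)%R by rewrite ltr_wpDl.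
have d0 : (0 < d)%R by rewrite !divr_gt0.
pose c k := (k.+1%:R * d)%R.
have c0 k : (0 < c k)%R by rewrite mulr_gt0.
(* [u] is the sum of the [c k] over open sets slightly larger than the
   level sets [E k]. *)
pose E k := D `&` g @^-1` `[(k%:R * d)%R, c k[.
have mE k : measurable (E k) by exact: mg.
(* Chosen so that the products [c k * ep k] sum to [e / 2]. *)
pose ep k := (e / 2 / (2 ^ k.+1)%:R / c k)%R.
have ep0 k : (0 < ep k)%R by rewrite !divr_gt0// ltr0n expn_gt0.
have ED k : E k `<=` D by move=> x [].
have Efin k : mu (E k) < +oo.
  apply: le_lt_trans Dfin; apply: le_measure => //; rewrite ?inE//.
  exact: mE.
have /choice[V HV] : forall k, exists U : set R,
    [/\ open U, E k `<=` U & mu (U `\` E k) < (ep k)%:E].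
  move=> k; apply: lebesgue_regularity_outer.
 exact: mE. exact: Efin. exact: ep0.
have oV k : open (V k) by case: (HV k).
have mV k : measurable (V k) by exact: open_measurable.
have EV k : E k `<=` V k by case: (HV k).
have muV k : mu (V k `\` E k) <= (ep k)%:E by case: (HV k) => _ _ /ltW.
pose u x := \sum_(k <oo) (c k * \1_(V k) x)%:E.
have u0 y k : 0 <= (c k * \1_(V k) y)%:E by rewrite lee_fin mulr_ge0// ltW.
have DE : D = \bigcup_k E k.
  apply/seteqP; split => [x Dx|x [k _] /ED//].
  have gd0 : (0 <= g x / d)%R by rewrite divr_ge0 ?g0// ltW.
  exists (Num.truncn (g x / d)) => //; split => //=.
  by rewrite in_itv/= -ler_pdivlMr// -ltr_pdivrMr// truncn_itv.
have tE : trivIset setT E.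
  apply/trivIsetP => i j _ _ ij; apply/seteqP; split => // x.
  wlog : i j ij / (i < j)%N.
    move=> W; have [/W|/W|/eqP] := ltngtP i j; first exact.
      by rewrite setIC; apply; rewrite // eq_sym.
    by rewrite (negbTE ij).
  move=> iltj -[[_ /=]]; rewrite in_itv/= => /andP[_ gi] [_ /=].
  rewrite in_itv/= => /andP[gj _].
  have := le_lt_trans gj gi.
  by rewrite /c ltr_pM2r// ltr_nat ltnS leqNgt iltj.
exists u; split.
- by apply: lower_semicontinuous_series_indic => // k; exact: ltW.
- by move=> x; apply: nneseries_ge0 => k _ _; exact: u0.
- move=> x; rewrite {1}DE => -[k _ Ekx].
  have gc : (g x < c k)%R by case: Ekx => _ /=; rewrite in_itv/= => /andP[].
  rewrite (@lt_le_trans _ _ (c k * \1_(V k) x)%:E)//.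
    by rewrite indicE mem_set ?mulr1 ?lte_fin//; exact: EV.
  apply: le_trans (nneseries_lim_ge k.+1 _); last first.
    by move=> i _ _; exact: u0.
  by rewrite big_nat_recr//= leeDr// sume_ge0.
have mcV k : measurable_fun setT (fun x => (c k * \1_(V k) x)%:E).
  by apply/measurable_EFinP/measurable_funM => //; exact: measurable_indic.
have -> : \int[mu]_(x in D) u x =
    \sum_(k <oo) \int[mu]_(x in D) (c k * \1_(V k) x)%:E.
  rewrite integral_nneseries// => k.
  by apply: measurable_funTS; exact: mcV.
have mgd : measurable_fun D (fun x => (g x + d)%:E).
  by apply/measurable_EFinP; exact: measurable_funD.
have gd0 x : D x -> 0 <= (g x + d)%:E.
  by move=> Dx; rewrite lee_fin addr_ge0 ?g0 ?ltW.
(* On [E k] the weight [c k] is at most [g + d], and the excess of [V k] over [E k] contributes at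
   most [c k * ep k]. *)
apply: (@le_trans _ _ (\sum_(k <oo)
    (\int[mu]_(x in E k) (g x + d)%:E + (e / 2 / (2 ^ k.+1)%:R)%:E))).
  apply: lee_nneseries => [k _ _|k _].
    by apply: integral_ge0 => x _; exact: u0.
  under eq_integral do rewrite EFinM.
  rewrite ge0_integralZl//; last 2 first.
  - by apply/measurable_EFinP/measurable_funTS/measurable_indic; exact: mV.
  - by rewrite lee_fin ltW.
  rewrite integral_indic//; last exact: mV.
  apply: (@le_trans _ _ ((c k)%:E * (mu (E k) + (ep k)%:E))).
    rewrite lee_pmul2l//; last by rewrite lte_fin.
    apply: (@le_trans _ _ (mu (E k `|` (V k `\` E k)))).
      apply: le_measure; rewrite ?inE.
      + by apply: measurableI; [exact: mV|exact: mD].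
      + apply: measurableU; first exact: mE.
        by apply: measurableD; [exact: mV|exact: mE].
      + by move=> x [Ox _]; have [Ex|Ex] := pselect (E k x); [left|right].
    apply: (le_trans (measureU2 _ _ _)).
    - exact: mE.
    - by apply: measurableD; [exact: mV|exact: mE].
    - by rewrite leeD2l//; exact: muV.
  rewrite muleDr//; last by rewrite ge0_adde_def// inE// ?lee_fin ltW.
  apply: leeD; last first.
    by rewrite -EFinM lee_fin /ep mulrC divfK// gt_eqF.
  rewrite -integral_cst; last exact: mE.
  apply: ge0_le_integral.
  - exact: mE.
  - by move=> x _; rewrite lee_fin ltW.
  - exact: measurable_cst.
  - exact: measurable_funS mgd.
  - move=> x [_ /=]; rewrite in_itv/= => /andP[gk _].
    by rewrite lee_fin /c -natr1 mulrDl mul1r lerD2r.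
apply: le_trans (epsilon_trick _ _ _) _; [|by rewrite divr_ge0 ?ltW|].
  by move=> k; apply: integral_ge0 => x /ED; exact: gd0.
rewrite -ge0_integral_bigcup -?DE//.
under eq_integral do rewrite EFinD.
rewrite ge0_integralD//; last 2 first.
- exact/measurable_EFinP.
- by move=> x Dx; rewrite lee_fin ltW.
rewrite integral_cst// -addeA; apply: leeD2l.
have -> : d%:E * lebesgue_measure D = (d * m)%:E by rewrite [RHS]EFinM -muD.
rewrite -EFinD lee_fin [leRHS](splitr e) lerD2r.
rewrite /d mulrAC ler_pdivrMr// ler_wpM2l//; last by rewrite lerDl.
by rewrite divr_ge0// ltW.
Qed.

End VitaliCaratheodory.

Section FTC_integrable.
Context {R : realType}.
Notation mu := (@lebesgue_measure R).

Lemma within_continuous_ball (A : set R) (F : R -> R) x :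
  {within A, continuous F} -> A x -> forall e, 0 < e -> exists2 d, 0 < d &
    forall y, A y -> `|x - y| < d -> `|F x - F y| < e.
Proof.
move=> /subspace_continuousP cF Ax e e0.
have /cvgrPdist_lt/(_ e e0) := cF x Ax.
move=> /nbhs_ballP[d /= d0 dF]; exists d => // y Ay xy.
exact: (dF y).
Qed.

Lemma is_derive_lt_right (F : R -> R) (x l k : R) :
  is_derive x 1 F l -> l < k ->
  exists2 d, 0 < d & forall h, 0 < h < d -> F (x + h) - F x < k * h.
Proof.
move=> [dF Fl] lk; move: dF => /cvg_ex[l' Fl'].
have {}Fl' : (fun h => h^-1 *: ((F \o shift x) (h *: 1) - F x)) @ 0^' --> l.
  by rewrite -Fl /derive (cvg_lim _ Fl').
have /cvgrPdist_lt/(_ (k - l)) := Fl'.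
rewrite subr_gt0 => /(_ lk).
move=> /nbhs_ballP[d /= d0 dF]; exists d => // h /andP[h0 hd].
have := dF h; rewrite /ball/= sub0r normrN gtr0_norm// => /(_ hd).
move=> /(_ (lt0r_neq0 h0)).
rewrite /= [h *: 1]mulr1 [h + x]addrC ltr_norml => /andP[+ _].
rewrite -[_ *: _]/(h^-1 * _) opprB ltrD2l ltrN2 => q.
by rewrite -ltr_pdivrMr// mulrC.
Qed.

(** A continuation argument: let [s] be the supremum of the points up to which the bound holds. If
    [s < b], some constant [k] satisfies [g s < k <= u] near [s], so just to the right of [s] the
    function [F] grows by less than [k * h], which the integral of [u] dominates, and the bound
    extends past [s]. *)
Lemma le_integral_lower_semicontinuous (F g : R -> R) (u : R -> \bar R) a b :
  a < b -> {within `[a, b], continuous F} ->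
  (forall x : R, a < x < b -> is_derive x 1 F (g x)) ->
  lower_semicontinuous u -> (forall x, 0 <= u x)%E ->
  (forall x, a < x < b -> ((g x)%:E < u x)%E) ->
  ((F b - F a)%:E <= \int[mu]_(x in `[a, b]) u x)%E.
Proof.
move=> ab cF dF lu u0 gu.
have mu_ A : measurable A -> measurable_fun A u.
  by move=> mA; apply: measurable_funTS; exact: lower_semicontinuous_measurable.
have le_int (A B : set R) : measurable A -> measurable B -> A `<=` B ->
    (\int[mu]_(x in A) u x <= \int[mu]_(x in B) u x)%E.
  by move=> mA mB AB; apply: ge0_subset_integral => //; exact: mu_.
(* The derivative of [F] is only controlled inside the interval. *)
suff inner c : a < c < b -> ((F b - F c)%:E <= \int[mu]_(x in `[a, b]) u x)%E.
  apply/lee_addgt0Pr => e e0.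
  have [|d d0 Fd] := @within_continuous_ball _ _ a cF _ _ e0.
    by rewrite /= in_itv/= lexx ltW.
  pose c := a + Num.min (d / 2) ((b - a) / 2).
  have m0 : 0 < Num.min (d / 2) ((b - a) / 2).
    by rewrite lt_min !divr_gt0// subr_gt0.
  have md : Num.min (d / 2) ((b - a) / 2) <= d / 2 by rewrite ge_min lexx.
  have mb : Num.min (d / 2) ((b - a) / 2) <= (b - a) / 2.
    by rewrite ge_min lexx orbT.
  have acb : a < c < b by rewrite /c; apply/andP; split; lra.
  have /andP[ac cb] := acb.
  have : `|F a - F c| < e.
    apply: Fd; first by rewrite /= in_itv/= !ltW.
    by rewrite ler0_norm /c; lra.
  rewrite ltr_norml => /andP[Fac _].
  apply: (@le_trans _ _ ((F b - F c)%:E + e%:E)%E).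
    by rewrite -EFinD lee_fin; lra.
  by rewrite leeD2r// inner.
move=> /andP[ac cb].
pose Phi y := (\int[mu]_(x in `[c, y]) u x)%E.
have Phi_le x y : x <= y -> (Phi x <= Phi y)%E.
  by move=> xy; apply: le_int => //; apply: subset_itvl; rewrite bnd_simp.
pose S := [set y | [/\ c <= y, y <= b & ((F y - F c)%:E <= Phi y)%E]].
have Sc : S c by split => //; [exact: ltW|rewrite subrr integral_ge0].
have supS : has_sup S by split; [exists c|exists b => y []].
set s := sup S.
have cs : c <= s by apply: sup_upper_bound => //.
have sb : s <= b by apply: sup_le_ub; [exists c|move=> y []].
(* Continuity of [F] and monotonicity of [Phi] carry the bound from points of [S] close to [s] to
   [s] itself. *)
have Ss : S s.
  split => //; apply/lee_addgt0Pr => e e0.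
  have [|d d0 Fd] := @within_continuous_ball _ _ s cF _ _ e0.
    by rewrite /= in_itv/= sb (le_trans (ltW ac)).
  have [y Sy sdy] := sup_adherent d0 supS.
  have ys : y <= s by exact: sup_upper_bound.
  have [cy yb Fy] := Sy.
  have : `|F s - F y| < e.
    apply: Fd; first by rewrite /= in_itv/= yb (le_trans (ltW ac)).
    by rewrite ger0_norm ?subr_ge0// ltrBlDr -ltrBlDl.
  rewrite ltr_norml => /andP[_ Fsy].
  apply: (@le_trans _ _ ((F y - F c)%:E + e%:E)%E).
    by rewrite -EFinD lee_fin; lra.
  by rewrite leeD2r// (le_trans Fy)// Phi_le.
have [sb'|] := ltP s b; last first.
  move=> bs; have <- : s = b by apply/eqP; rewrite eq_le sb bs.
  case: Ss => _ _ /le_trans; apply; apply: le_int => //.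
  by apply: subset_itv; rewrite bnd_simp// ltW.
exfalso.
have asb : a < s < b by rewrite sb' (lt_le_trans ac).
(* Take [k] strictly between [g s] and [u s]; lower semicontinuity keeps [u] above it near [s]. A
   negative [k] is replaced by 0, which also lies below [u]. *)
have [k [k0 gk uk]] : exists k,
    [/\ 0 <= k, g s < k & \forall y \near s, (k%:E <= u y)%E].
  have [k [gk ku]] : exists k, g s < k /\ (k%:E < u s)%E.
    have := gu _ asb; case: (u s) => [r| |]; rewrite ?lte_fin => gr.
    - exists ((g s + r) / 2); rewrite lte_fin; split; lra.
    - by exists (g s + 1); rewrite ltry; split => //; lra.
    - by [].
  have [k0|k0] := leP 0 k; last first.
    by exists 0; split => //; [exact: lt_trans k0|near=> y].
  have [V Vs Vu] := lu _ _ ku.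
  by exists k; split => //; apply: filterS Vs => y /Vu /ltW.
have [d d0 Fd] := is_derive_lt_right _ _ _ _ (dF _ asb) gk.
have /nbhs_ballP[e /= e0 eu] := uk.
pose h := Num.min (Num.min (d / 2) (e / 2)) (b - s).
have h0 : 0 < h by rewrite !lt_min !divr_gt0// subr_gt0.
have hd : h <= d / 2 by rewrite !ge_min lexx.
have he : h <= e / 2 by rewrite !ge_min lexx orbT.
have hb : h <= b - s by rewrite !ge_min lexx !orbT.
suff : S (s + h) by move=> /(sup_upper_bound supS); rewrite gerDl leNgt h0.
split; [lra|lra|].
have [_ _ Fs] := Ss.
have hd' : 0 < h < d by rewrite h0/=; lra.
apply: (@le_trans _ _ ((F s - F c)%:E + (k * h)%:E)%E).
  by rewrite -EFinD lee_fin; have := Fd h hd'; lra.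
have -> : Phi (s + h) = (Phi s + \int[mu]_(x in `]s, (s + h)%R]) u x)%E.
  rewrite /Phi -ge0_integral_setU//.
  - by congr (integral _ _ _); rewrite -itv_bndbnd_setU// bnd_simp; lra.
  - by apply: mu_; exact: measurableU.
  - apply/eqP; rewrite setIC -subset0 => x [] /=; rewrite !in_itv/=; lra.
apply: leeD => //.
apply: (@le_trans _ _ (\int[mu]_(x in `]s, (s + h)%R]) k%:E)%E).
  rewrite integral_cst//= lebesgue_measure_itv/= lte_fin ltrDl h0.
  by rewrite -EFinD -EFinM lee_fin; lra.
apply: ge0_le_integral => //.
- exact: mu_.
- move=> x /=; rewrite in_itv/= => sx; apply: eu.
  by rewrite /ball/= ltr0_norm; lra.
Unshelve. all: by end_near. Qed.

End FTC_integrable.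

Section FTC_integrable.
Context {R : realType}.
Notation mu := (@lebesgue_measure R).

Lemma integrable_segment_cst (a b k : R) :
  mu.-integrable `[a, b] (EFin \o cst k).
Proof.
apply: continuous_compact_integrable; first exact: segment_compact.
by apply: continuous_subspaceT => x; exact: cvg_cst.
Qed.

(** The truncation [G n] of [g] from below becomes nonnegative after adding [n], so it has a lower
    semicontinuous majorant. The added [n * (b - a)] cancels on both sides, and dominated
    convergence removes the truncation. *)
Lemma le_integral_derive (F g : R -> R) a b : a < b ->
  {within `[a, b], continuous F} ->
  (forall x : R, a < x < b -> is_derive x 1 F (g x)) ->
  mu.-integrable `[a, b] (EFin \o g) ->
  ((F b - F a)%:E <= \int[mu]_(x in `[a, b]) (g x)%:E)%E.
Proof.
move=> ab cF dF ig.
have mD : measurable (`[a, b]%classic : set R) by exact: measurable_itv.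
have mg : measurable_fun `[a, b] g.
  by apply/measurable_EFinP; exact: measurable_int ig.
have muD : mu `[a, b] = (b - a)%:E.
  by rewrite lebesgue_measure_itv/= lte_fin ab EFinB.
pose G n x := Num.max (g x) (- n%:R).
have mG n : measurable_fun `[a, b] (G n).
  by apply: measurable_maxr => //; exact: measurable_cst.
have G_le n x : `|G n x| <= `|g x|.
  rewrite /G; case: (leP (g x) (- n%:R)) => [gn|//].
  have n0 : 0 <= n%:R :> R by [].
  by rewrite normrN ger0_norm// ler0_norm; lra.
have iG n : mu.-integrable `[a, b] (EFin \o G n).
  apply: le_integrable ig => //.
    by apply/measurable_EFinP; exact: mG.
  by move=> x _; rewrite lee_fin.
have FG n : ((F b - F a)%:E <= \int[mu]_(x in `[a, b]) (G n x)%:E)%E.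
  apply/lee_addgt0Pr => e e0.
  have [|||u [lu u0 gu iu]] := @ge0_lower_semicontinuous_majorant _ `[a, b]
      (fun x => G n x + n%:R) e mD _ _ _ e0.
  - by rewrite muD ltry.
  - by apply: measurable_funD => //; exact: measurable_cst.
  - by move=> x _; rewrite -lerBlDr sub0r le_max lexx orbT.
  (* The derivative [g + n] of [F + n * id] is at most [G n + n], hence below [u]. *)
  have Fu : ((F b + n%:R * b - (F a + n%:R * a))%:E <=
      \int[mu]_(x in `[a, b]) u x)%E.
    apply: (@le_integral_lower_semicontinuous _ (F + n%:R *: @idfun R)
      (fun x => g x + n%:R) u a b ab _ _ lu u0).
    - apply: within_continuousD => //; apply: continuous_subspaceT => x.
      by apply: cvgZ; [exact: cvg_cst|exact: cvg_id].
    - move=> x /dF ?; apply: is_derive_eq.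
      by rewrite [_ *: _]mulr1.
    - move=> x /andP[ax xb]; apply: le_lt_trans (gu x _).
        by rewrite lee_fin lerD2r le_max lexx.
      by rewrite /= in_itv/= !ltW.
  have := le_trans Fu iu.
  under eq_integral do rewrite EFinD.
  rewrite integralD//=; [|exact: iG|exact: integrable_segment_cst].
  rewrite integral_cst//= muD -EFinM.
  have -> : F b + n%:R * b - (F a + n%:R * a) = F b - F a + n%:R * (b - a).
    by ring.
  by rewrite EFinD addeAC leeD2rE.
have mEG n : measurable_fun `[a, b] (fun x => (G n x)%:E) 
  by apply/measurable_EFinP; exact: mG.
(* At each point the sequence is constant as soon as [n] exceeds [|g x|]. *)
have Gg : {ae mu, forall x,
    `[a, b]%classic x -> (G n x)%:E @[n --> \oo] --> (g x)%:E}.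
  apply: aeW => x _; apply: cvg_near_cst.
  exists (Num.truncn `|g x|).+1 => // n /= gn; congr EFin; apply/max_idPl.
  rewrite lerNl (le_trans (ler_norm _))// normrN ltW//.
  by rewrite (lt_le_trans (truncnS_gt _))// ler_nat.
have G_dom : {ae mu, forall x n,
    `[a, b]%classic x -> (`|(G n x)%:E| <= `|(g x)%:E|)%E}.
  by apply: aeW => x n _; rewrite lee_fin.
have [_ _ /= cG] := @dominated_convergence _ _ _ mu _ mD _ _ _ mEG
  (measurable_int _ ig) Gg (integrable_abse ig) G_dom.
rewrite -(cvg_lim (@ereal_hausdorff R) cG).
by apply: lime_ge; [apply/cvg_ex; eexists; exact: cG|exact: nearW].
Qed.

Theorem integrable_FTC2 (F g : R -> R) a b : a <= b ->
  {within `[a, b], continuous F} ->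
  (forall x : R, a < x < b -> is_derive x 1 F (g x)) ->
  mu.-integrable `[a, b] (EFin \o g) ->
  (\int[mu]_(x in `[a, b]) (g x)%:E = (F b - F a)%:E)%E.
Proof.
rewrite le_eqVlt => /predU1P[<- _ _ _|ab cF dF ig].
  by rewrite set_itv1 integral_set1 subrr.
apply/eqP; rewrite eq_le; apply/andP; split; last exact: le_integral_derive.
have dNF (x : R) : a < x < b -> is_derive x 1 (- F) (- g x).
  by move=> /dF; exact: is_deriveN.
have := @le_integral_derive (- F) (- g) a b ab _ dNF.
have -> : (- F) b - (- F) a = - (F b - F a).
  by rewrite -[LHS]/(- F b - - F a); ring.
rewrite EFinN.
have -> : (\int[mu]_(x in `[a, b]) ((- g) x)%:E =
    - \int[mu]_(x in `[a, b]) (g x)%:E)%E.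
  by rewrite -integralN//; exact: integrable_add_def.
rewrite leeN2; apply; last first.
  rewrite (_ : EFin \o - g = -%E \o (EFin \o g))//; exact: integrableN ig.
by move=> x; apply: continuousN; exact: cF.
Qed.

End FTC_integrable.

(** * Substitution in Lebesgue integrals *)

Section pushforward_density.
Local Open Scope ereal_scope.
Context d d' (T : measurableType d) (T' : measurableType d') (R : realType).
Variables (mu : {measure set T -> \bar R}) (phi : T -> T') (w : T -> R).

(** The proofs of measurability and sign are arguments so that the measure structure declared below
    can be inferred from the term itself. *)
Definition pushforward_density of measurable_fun setT phi
    & measurable_fun setT w & (forall x, (0 <= w x)%R) :=
  fun A : set T' => \int[mu]_(x in phi @^-1` A) (w x)%:E.

Hypothesis mphi : measurable_fun setT phi.
Hypothesis mw : measurable_fun setT w.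
Hypothesis w0 : forall x, (0 <= w x)%R.

Let nu := pushforward_density mphi mw w0.

Let nu0 : nu set0 = 0.
Proof. by rewrite /nu /pushforward_density preimage_set0 integral_set0. Qed.

Let nu_ge0 A : 0 <= nu A.
Proof. by apply: integral_ge0 => x _; rewrite lee_fin. Qed.

Let mEw : measurable_fun setT (EFin \o w).
Proof. exact/measurable_EFinP. Qed.

Let mpre A : measurable A -> measurable (phi @^-1` A).
Proof. by move=> mA; rewrite -[X in measurable X]setTI; exact: mphi. Qed.

Let nu_sigma_additive : semi_sigma_additive nu.
Proof.
move=> F mF tF mUF; rewrite /nu /pushforward_density preimage_bigcup.
have Ew0 x : 0 <= (EFin \o w) x by rewrite lee_fin.
apply: (semi_sigma_additive_nng_induced mEw Ew0).
- by move=> i; exact: mpre.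
- by apply/trivIsetP => i j _ _ ij; rewrite -preimage_setI;
     move/trivIsetP : tF => ->//; rewrite preimage_set0.
- by rewrite -preimage_bigcup; exact: mpre.
Qed.

HB.instance Definition _ := isMeasure.Build _ _ _
  (pushforward_density mphi mw w0) nu0 nu_ge0 nu_sigma_additive.

Import HBNNSimple.

(** The formula holds for indicators by assumption, for simple functions by linearity, and passes to
    the limit by monotone convergence on both sides. A general [m] is allowed so that restricted
    Lebesgue measure can be inserted. *)
Lemma ge0_integral_pushforward_density (m : {measure set T' -> \bar R}) g :
  (forall A, measurable A -> m A = \int[mu]_(x in phi @^-1` A) (w x)%:E) ->
  measurable_fun setT g -> (forall y, 0 <= g y) ->
  \int[m]_y g y = \int[mu]_x (g (phi x) * (w x)%:E).
Proof.
move=> mE mg g0; pose g_ := nnsfun_approx measurableT mg.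
have mgphi n : measurable_fun setT (fun x => (g_ n (phi x))%:E).
  by apply/measurable_EFinP; exact: measurableT_comp.
have step n : \int[m]_y (g_ n y)%:E = \int[mu]_x ((g_ n (phi x))%:E * (w x)%:E).
  under eq_integral do rewrite fimfunE -fsumEFin//.
  rewrite ge0_integral_fsum//; last 2 first.
  - by move=> r; exact/measurable_EFinP/measurableT_comp.
  - by move=> r y _; rewrite EFinM nnfun_muleindic_ge0.
  under [RHS]eq_integral.
    move=> x _; rewrite fimfunE -fsumEFin// ge0_mule_fsuml; last first.
      by move=> r; rewrite EFinM nnfun_muleindic_ge0.
    over.
  rewrite [RHS]ge0_integral_fsum//; last 2 first.
  - move=> r; apply: emeasurable_funM => //; apply/measurable_EFinP.
    by apply: measurable_funM => //; apply: measurableT_comp mphi.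
  - move=> r x _; apply: mule_ge0; first exact: nnfun_muleindic_ge0.
    by rewrite lee_fin.
  apply: eq_fsbigr => r _.
  rewrite integralZl_indic_nnsfun// integral_indic// setIT mE//.
  under [RHS]eq_integral do rewrite EFinM -muleA.
  (* A nonnegative simple function does not take a negative value [r]: its fibre is empty and both
     sides vanish. *)
  have [r0|r0] := ltP r 0%R.
    rewrite preimage_nnfun0// preimage_set0 integral_set0 mule0.
    rewrite integral0_eq// => x _.
    by rewrite indicE in_set0 mul0e mule0.
  rewrite ge0_integralZl//; last 2 first.
  - apply: emeasurable_funM => //; apply/measurable_EFinP.
    by apply: measurableT_comp mphi.
  - by move=> x _; rewrite mule_ge0// lee_fin.
  congr (_ * _); rewrite [LHS]integral_mkcond; apply: eq_integral => x _.
  rewrite patchE indicE -[x \in _]/(phi x \in g_ n @^-1` [set r]).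
  by case: ifPn => _; rewrite ?mul1e ?mul0e.
transitivity (limn (fun n => \int[m]_y (g_ n y)%:E)).
  rewrite -monotone_convergence//.
  - apply: eq_integral => y _; apply/esym/cvg_lim => //.
    exact: cvg_nnsfun_approx.
  - by move=> n; exact/measurable_EFinP.
  - by move=> n y _; rewrite lee_fin.
  - by move=> y _ i j ij; rewrite lee_fin; exact/lefP/nd_nnsfun_approx.
under eq_fun do rewrite step.
rewrite -monotone_convergence//.
- apply: eq_integral => x _; apply/cvg_lim => //.
  by apply: cvgeZr => //; exact: cvg_nnsfun_approx.
- by move=> n; exact: emeasurable_funM.
- by move=> n x _; rewrite mule_ge0// lee_fin.
- move=> x _ i j ij; apply: lee_wpmul2r; rewrite lee_fin//.
  exact/lefP/nd_nnsfun_approx.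
Qed.

End pushforward_density.

Section increasing_substitution.
Context {R : realType}.
Notation mu := (@lebesgue_measure R).
Variables (phi w : R -> R) (a b : R).
Hypothesis ab : a <= b.
Hypothesis phi_incr : {in `[a, b] &, {homo phi : x y / x < y}}.
Hypothesis phi_cont : {within `[a, b], continuous phi}.
Hypothesis dphi : forall x : R, a < x < b -> is_derive x 1 phi (w x).
Hypothesis w0 : forall x, a <= x <= b -> 0 <= w x.
Hypothesis iw : mu.-integrable `[a, b] (EFin \o w).

Let mD : measurable (`[a, b]%classic : set R).
Proof. exact: measurable_itv. Qed.

Let phi_mono : {in `[a, b] &, {mono phi : x y / x <= y}}.
Proof. exact: le_mono_in. Qed.

Let phi_ab x : a <= x <= b -> phi a <= phi x <= phi b.
Proof.
move=> /andP[ax xb].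
by rewrite !phi_mono// ?in_itv/= ?lexx ?ax ?xb ?ab.
Qed.

Let phiab : phi a <= phi b.
Proof. by rewrite phi_mono// in_itv/= lexx ab. Qed.

(** Shows that the part of [[a, b]] sent into the ray from [y] is [[s, b]]. The maximum with [phi a]
    brings the target into the range of [phi], so that the intermediate value theorem provides
    [s]. *)
Let preimage_phi y : y <= phi b ->
  exists2 s, a <= s <= b & [/\ phi s = Num.max (phi a) y &
    forall x, a <= x <= b -> (y <= phi x) = (s <= x)].
Proof.
move=> yb.
have [|s] := @IVT _ phi a b (Num.max (phi a) y) ab phi_cont.
  by rewrite (min_l phiab) (max_r phiab) le_max lexx/= ge_max phiab.
rewrite in_itv/= => sab phis; exists s => //; split => // x xab.
have /andP[ax _] := phi_ab _ xab.
by rewrite -(phi_mono s x) ?in_itv//= phis ge_max ax.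
Qed.

(** Extension by zero gives measurable functions on the whole line. The value 0 of [psi] outside
    [[a, b]] is harmless because [v] vanishes there. *)
Let psi := phi \_ `[a, b].
Let v := w \_ `[a, b].

Let mpsi : measurable_fun setT psi.
Proof.
apply/(measurable_restrictT phi mD).
exact: subspace_continuous_measurable_fun.
Qed.

Let mv : measurable_fun setT v.
Proof.
apply/(measurable_restrictT w mD).
by apply/measurable_EFinP; exact: measurable_int iw.
Qed.

Let v0 x : 0 <= v x.
Proof.
rewrite /v patchE; case: ifPn => //; rewrite inE/= in_itv/=; exact: w0.
Qed.

Let integral_v (A : set R) : measurable A ->
  (\int[mu]_(x in psi @^-1` A) (v x)%:E =
   \int[mu]_(x in `[a, b] `&` phi @^-1` A) (w x)%:E)%E.
Proof.
move=> mA; rewrite [LHS]integral_mkcond [RHS]integral_mkcond.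
apply: eq_integral => x _; rewrite !patchE in_setI.
rewrite -[x \in psi @^-1` A]/(psi x \in A) -[x \in phi @^-1` A]/(phi x \in A).
rewrite /psi /v !patchE.
by have [xab|xab] := boolP (x \in `[a, b]%classic); rewrite /=; case: ifP.
Qed.

(** The closed rays to the right are stable under intersection, generate the Borel sets and exhaust
    the line, so it suffices to compare finite measures on them. On a ray meeting the image, the
    density integrates over [[s, b]] to [phi b - phi s], the length of the part of [[phi a, phi b]]
    in the ray. *)
Let measure_psi (A : set (measurableTypeR R)) : measurable A ->
  mrestr mu (measurable_itv `[phi a, phi b]) A =
  (\int[mu]_(x in psi @^-1` A) (v x)%:E)%E.
Proof.
pose m1 : {measure set (measurableTypeR R) -> \bar R} :=
  mrestr mu (measurable_itv `[phi a, phi b]).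
pose m2 : {measure set (measurableTypeR R) -> \bar R} :=
  @pushforward_density _ _ (measurableTypeR R) (measurableTypeR R) R
    mu psi v mpsi mv v0.
rewrite -[RHS]/(m2 A) -[LHS]/(m1 A); move: A.
move=> A mA.
refine (@measure_unique _ R (measurableTypeR R) (@RGenCInfty.G R)
  (fun n => `[(- n%:R), +oo[%classic) _ _ _ _ m1 m2 _ _ A mA).
- exact: RGenCInfty.measurableE.
- move=> _ _ [x ->] [y ->]; exists (Num.max x y).
  apply/seteqP; split => z /=; rewrite !in_itv/= !andbT ge_max.
    by case=> -> ->.
  by case/andP.
- by move=> n; eexists.
- apply/seteqP; split => // x _; exists (Num.truncn (- x)).+1 => //=.
  by rewrite in_itv/= andbT lerNl ltW// truncnS_gt.
- move=> _ [y ->].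
  have -> : m2 `[y, +oo[%classic =
      (\int[mu]_(x in `[a, b] `&` phi @^-1` `[y, +oo[) (w x)%:E)%E.
    by apply: integral_v; exact: measurable_itv.
  rewrite -[m1 _]/(mu (`[y, +oo[ `&` `[phi a, phi b])).
  have [yb|y_gt] := leP y (phi b); last first.
    rewrite (_ : _ `&` _ = set0) ?measure0; last first.
      rewrite -subset0 => z [] /=; rewrite !in_itv/= andbT => yz /andP[_ zb].
      by have := lt_le_trans y_gt (le_trans yz zb); rewrite ltxx.
    rewrite (_ : _ `&` _ = set0) ?integral_set0// -subset0 => x [] /=.
    rewrite !in_itv/= andbT => /phi_ab/andP[_ xb] yx.
    by have := lt_le_trans y_gt (le_trans yx xb); rewrite ltxx.
  have [s /andP[a_le_s sb] [phis yphi]] := preimage_phi _ yb.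
  rewrite (_ : _ `&` _ = `[phi s, phi b]%classic); last first.
    rewrite phis; apply/seteqP; split => z /=; rewrite !in_itv/= andbT ge_max.
      by move=> [-> /andP[-> ->]].
    by move=> /andP[/andP[-> ->] ->].
  rewrite (_ : _ `&` _ = `[s, b]%classic); last first.
    apply/seteqP; split => z /=; rewrite !in_itv/= andbT.
      by move=> [zab]; rewrite yphi// => ->; case/andP : zab.
    move=> /andP[sz zb]; have zab : a <= z <= b.
      by rewrite zb (le_trans a_le_s sz).
    by rewrite yphi.
  have sub : `[s, b] `<=` `[a, b] by apply: subset_itvr; rewrite bnd_simp.
  have -> : (\int[mu]_(x in `[s, b]) (w x)%:E = (phi b - phi s)%:E)%E.
    apply: integrable_FTC2 => //.
    + exact: continuous_subspaceW phi_cont.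
    + by move=> x /andP[sx xb]; apply: dphi; rewrite xb (le_lt_trans a_le_s).
    + exact: integrableS iw.
  have : phi s <= phi b by rewrite phi_mono// in_itv/= ?a_le_s ?sb ?lexx ?ab.
  rewrite lebesgue_measure_itv/= lte_fin le_eqVlt => /predU1P[->|->].
    by rewrite ltxx subrr.
  by rewrite EFinB.
- move=> n; apply: le_lt_trans (ltry (phi b - phi a)).
  rewrite -[m1 _]/(mu (`[- n%:R, +oo[ `&` `[phi a, phi b])).
  apply: (@le_trans _ _ (mu `[phi a, phi b])).
    by apply: le_measure; rewrite ?inE//; apply: measurableI.
  rewrite lebesgue_measure_itv/= lte_fin; case: ifPn => //.
  by rewrite lee_fin subr_ge0.
Qed.

Lemma ge0_increasing_substitution (g : R -> \bar R) :
  measurable_fun `[phi a, phi b] g ->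
  (forall y, phi a <= y <= phi b -> (0 <= g y)%E) ->
  (\int[mu]_(y in `[phi a, phi b]) g y =
   \int[mu]_(x in `[a, b]) (g (phi x) * (w x)%:E))%E.
Proof.
move=> mg g0; pose E : set R := `[phi a, phi b]%classic.
have mE : measurable E by exact: measurable_itv.
pose m := mrestr mu (measurable_itv `[phi a, phi b]).
transitivity (\int[m]_(y in E) g y)%E.
  by apply: eq_measure_integral => A mA AE;
    rewrite -[RHS]/(mu (A `&` E)) setIidl.
rewrite integral_mkcond.
rewrite (@ge0_integral_pushforward_density _ _ (measurableTypeR R)
  (measurableTypeR R) R mu psi v mpsi mv v0 m).
- rewrite [RHS]integral_mkcond; apply: eq_integral => x _.
  rewrite /v /psi !patchE.
  have [|xab] := boolP (x \in `[a, b]%classic); last by rewrite mule0.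
  rewrite inE/= in_itv/= => /phi_ab xab.
  by rewrite mem_set.
- exact: measure_psi.
- exact/(measurable_restrictT g mE).
- move=> y; rewrite patchE; case: ifPn => //.
  rewrite inE /E/= in_itv/=; exact: g0.
Qed.

(** The nonnegative case applied to [|g|] gives integrability, and applied to the positive and
    negative parts gives the identity; these operations commute with multiplication by [w >= 0]. *)
Lemma integrable_increasing_substitution (g : R -> R) :
  mu.-integrable `[phi a, phi b] (EFin \o g) ->
  mu.-integrable `[a, b] (fun x => (g (phi x) * w x)%:E) /\
  (\int[mu]_(y in `[phi a, phi b]) (g y)%:E =
   \int[mu]_(x in `[a, b]) (g (phi x) * w x)%:E)%E.
Proof.
move=> ig.
have mg : measurable_fun `[phi a, phi b] (EFin \o g) := measurable_int _ ig.
have phiw (h : R -> R) : measurable_fun `[phi a, phi b] h ->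
    measurable_fun `[a, b] (fun x => (h (phi x) * w x)%:E).
  move=> mh; apply/measurable_EFinP; apply: measurable_funM.
    apply: (measurable_comp _ _ mh); first exact: measurable_itv.
      by move=> _ [x + <-] /=; rewrite !in_itv/=; exact: phi_ab.
    exact: subspace_continuous_measurable_fun.
  by apply/measurable_EFinP; exact: measurable_int iw.
have wx x : `[a, b]%classic x -> 0 <= w x by rewrite /= in_itv/=; exact: w0.
have max0M y z : 0 <= z -> (maxe y%:E 0 * z%:E = maxe (y * z)%:E 0)%E.
  by move=> z0; rewrite -!EFin_max -EFinM maxr_pMl// mul0r.
split.
  apply/integrableP; split; first by apply: phiw; exact/measurable_EFinP.
  case/integrableP: ig => _.
  rewrite (ge0_increasing_substitution (fun y => `|(g y)%:E|%E))//; last first.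
    exact: measurableT_comp.
  apply: le_lt_trans; rewrite le_eqVlt; apply/orP; left; apply/eqP.
  apply: eq_integral => x; rewrite inE => /wx wx0.
  by rewrite /= normrM (ger0_norm wx0).
rewrite integralE [RHS]integralE; congr (_ - _)%E.
  rewrite ge0_increasing_substitution//; last exact: measurable_funepos.
  by apply: eq_integral => x; rewrite inE => /wx wx0; rewrite !funeposE max0M.
rewrite ge0_increasing_substitution//; last exact: measurable_funeneg.
apply: eq_integral => x; rewrite inE => /wx wx0.
by rewrite !funenegE -!EFinN max0M// mulNr.
Qed.

End increasing_substitution.

(** * Integration by parts *)

Section integration_by_parts.
Context {R : realType}.
Notation mu := (@lebesgue_measure R).

Lemma within_continuousM (A : set R) (F G : R -> R) :
  {within A, continuous F} -> {within A, continuous G} ->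
  {within A, continuous (F * G)}.
Proof.
move=> /subspace_continuousP cF /subspace_continuousP cG.
by apply/subspace_continuousP => x Ax; apply: cvgM; [exact: cF|exact: cG].
Qed.

(** The fundamental theorem applied to [F * G], whose derivative is a sum of two integrable
    terms. *)
Lemma integrable_by_parts (F G f g : R -> R) a b : a <= b ->
  {within `[a, b], continuous F} -> {within `[a, b], continuous G} ->
  (forall x : R, a < x < b -> is_derive x 1 F (f x)) ->
  (forall x : R, a < x < b -> is_derive x 1 G (g x)) ->
  mu.-integrable `[a, b] (fun x => (F x * g x)%:E) ->
  mu.-integrable `[a, b] (fun x => (f x * G x)%:E) ->
  \int[mu]_(x in `[a, b]) (F x * g x) =
  F b * G b - F a * G a - \int[mu]_(x in `[a, b]) (f x * G x).
Proof.
move=> ab cF cG dF dG iFg ifG.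
have iD : mu.-integrable `[a, b] (EFin \o (fun x => F x * g x + f x * G x)).
  exact: (integrableD _ iFg ifG).
apply/eqP; rewrite eq_sym subr_eq; apply/eqP.
rewrite -(RintegralD _ iFg ifG)//.
suff : (\int[mu]_(x in `[a, b]) (F x * g x + f x * G x)%:E =
    ((F * G) b - (F * G) a)%:E)%E by rewrite /Rintegral => ->.
apply: integrable_FTC2 => //.
  exact: within_continuousM.
move=> x xab; have ? := dF x xab; have ? := dG x xab; apply: is_derive_eq.
by rewrite -[_ *: g x]/(F x * g x) -[_ *: f x]/(G x * f x) [G x * _]mulrC.
Qed.

(** * Derivatives relative to a set, and reflection of integrals *)

Lemma derivable_within_ballP (D : set R) (F : R -> R) (x e : R) :
  derivable_within D F x -> 0 < e ->
  exists2 d, 0 < d & forall y, D y -> y != x -> `|x - y| < d ->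
    `|derive_within D F x - (F y - F x) / (y - x)| < e.
Proof.
move=> dF e0; have /cvgrPdist_lt/(_ e e0) := dF.
move=> /nbhs_ballP[d /= d0 Fd]; exists d => // y Dy yx xyd.
exact: (Fd y).
Qed.

(** Near [x] the difference quotients are bounded by [|l| + 1], so [F y - F x] is at most a constant
    times [y - x] in absolute value. *)
Lemma derivable_within_continuous_within (D : set R) (F : R -> R) :
  (forall x, D x -> derivable_within D F x) -> {within D, continuous F}.
Proof.
move=> dF; apply/subspace_continuousP => x Dx.
apply/cvgrPdist_lt => e e0.
have [d d0 Fd] := @derivable_within_ballP D F x 1 (dF x Dx) ltr01.
set l := derive_within D F x in Fd.
have l0 : 0 < `|l| + 1 by rewrite ltr_wpDl.
apply/nbhs_ballP; exists (Num.min d (e / (`|l| + 1))).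
  by rewrite /= lt_min d0 divr_gt0.
move=> y /=; rewrite /ball/= lt_min => /andP[xyd xye] Dy.
have [->|yx] := eqVneq y x; first by rewrite subrr normr0.
rewrite -/(from_subspace D F x) /from_subspace.
have yx0 : y - x != 0 by rewrite subr_eq0.
rewrite distrC -[F y - F x](divfK yx0) normrM.
have lq : `|(F y - F x) / (y - x)| <= `|l| + 1.
  rewrite -[X in `|X|](subKr l) (le_trans (ler_normB _ _))// lerD2l ltW//.
  exact: Fd.
rewrite distrC in xye.
by rewrite (le_lt_trans (ler_wpM2r _ lq))// mulrC -ltr_pdivlMr.
Qed.

(** A ball around an interior point lies in [D], so the restriction to [D] does not affect the
    limit. *)
Lemma is_derive_within (D : set R) (F : R -> R) (x : R) :
  D° x -> derivable_within D F x -> is_derive x 1 F (derive_within D F x).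
Proof.
move=> /nbhs_ballP[r /= r0 rD] dF.
have H : (fun h => h^-1 *: ((F \o shift x) (h *: 1) - F x)) @ 0^' -->
    derive_within D F x.
  apply/cvgrPdist_lt => e e0.
  have [d d0 Fd] := @derivable_within_ballP D F x e dF e0.
  apply/nbhs_ballP; exists (Num.min d r); first by rewrite /= lt_min d0.
  move=> h /=; rewrite /ball/= sub0r normrN lt_min => /andP[hd hr] h0.
  have xh : `|x - (h + x)| = `|h| by rewrite opprD addrCA subrr addr0 normrN.
  have := Fd (h + x); rewrite xh addrK -subr_eq0 addrK.
  rewrite [h *: 1]mulr1 [_ *: _]mulrC; apply => //.
  by apply: rD; rewrite /ball/= xh.
by split; [apply/cvg_ex; eexists; exact: H|exact: cvg_lim H].
Qed.

(** Invariance of Lebesgue measure under negation; it lets the increasing substitution treat the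
    decreasing path [Lpath]. *)
Lemma integrable_reflect (g : R -> R) (a b : R) :
  mu.-integrable `[a, b] (EFin \o g) ->
  mu.-integrable `[- b, - a] (fun x => (g (- x))%:E) /\
  (\int[mu]_(x in `[a, b]) (g x)%:E =
   \int[mu]_(x in `[(- b)%R, (- a)%R]) (g (- x)%R)%:E)%E.
Proof.
have E (h : R -> \bar R) : measurable_fun `[a, b] h -> (forall x, 0 <= h x)%E ->
    (\int[mu]_(x in `[a, b]) h x =
     \int[mu]_(x in `[(- b)%R, (- a)%R]) h (- x)%R)%E.
  move=> mh h0.
  pose N : measurableTypeR R -> measurableTypeR R := -%R.
  have mN : measurable_fun setT N by exact: oppr_measurable.
  transitivity (\int[pushforward mu N]_(x in `[a, b]) h x)%E.
    by apply: eq_measure_integral => A mA _; exact/esym/lebesgue_measureN.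
  rewrite (ge0_integral_pushforward mN mu)//.
  by congr (integral _ _ _); rewrite /N opp_preimage_itvbndbnd.
move=> ig; have mg := measurable_int _ ig.
split.
  apply/integrableP; split.
    apply/measurable_EFinP; apply: (@measurable_comp _ _ _ _ _ _ `[a, b] g).
    - exact: measurable_itv.
    - by move=> _ [x + <-]; rewrite /= !in_itv/= => /andP[? ?];
        apply/andP; split; lra.
    - exact/measurable_EFinP.
    - exact: oppr_measurable.
  case/integrableP: ig => _; rewrite (E (fun x => `|(g x)%:E|%E))//.
  exact: measurableT_comp.
rewrite integralE [RHS]integralE !E//; last 2 first.
- exact: measurable_funeneg.
- exact: measurable_funepos.
by congr (_ - _)%E; apply: eq_integral => x _; rewrite ?funeposE ?funenegE.
Qed.

End integration_by_parts.

(** * The paths L and U *)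

Section harmonic_paths.
Context {R : realType}.
Notation mu := (@lebesgue_measure R).

Lemma harm_between (a b : R) : a < b -> 0 < a * b -> a < harm a b < b.
Proof.
move=> ab ab0.
(* Otherwise [a * b] would be [- a ^+ 2], which is not positive. *)
have s0 : a + b != 0 by apply/eqP => s0; have := sqr_ge0 a; nra.
have [sp|sn] := ltP 0 (a + b).
  have b0 : 0 < b by lra.
  have a0 : 0 < a by nra.
  by rewrite /harm ltr_pdivlMr// ltr_pdivrMr//; apply/andP; split; nra.
have sn' : a + b < 0 by rewrite lt_neqAle s0.
rewrite /harm ltr_ndivlMr// ltr_ndivrMr//; apply/andP; split; nra.
Qed.

(** The harmonic mean is odd and symmetric, so negating and exchanging the endpoints turns one path
    into the other. *)
Lemma Lpath_Upath (a b t : R) : Lpath a b t = - Upath (- b) (- a) t.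
Proof.
have -> : Upath (- b) (- a) t = - Lpath a b t; last by rewrite opprK.
have E : harm (- b) (- a) = - harm a b.
  by rewrite /harm -opprD invrN [b + a]addrC !mulrN !mulNr opprK; ring.
rewrite /Upath /Lpath E mulrNN !mulrN -opprD invrN mulrN.
by congr (- (_ / _)); ring.
Qed.

Section Upath_substitution.
Variables (a b : R).
Hypotheses (ab : a < b) (ab0 : 0 < a * b).
Let H := harm a b.
Let den t := t * H + (1 - t) * b.

Let a_neq0 : a != 0.
Proof. by apply: contraTneq ab0 => ->; rewrite mul0r ltxx. Qed.

Let b_neq0 : b != 0.
Proof. by apply: contraTneq ab0 => ->; rewrite mulr0 ltxx. Qed.

Let bH : 0 < b * H.
Proof.
have /andP[] := harm_between a b ab ab0; rewrite -/H => aH Hb.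
have [a0|a0] := ltP 0 a.
  by rewrite mulr_gt0// (lt_trans a0)//.
have b0 : b < 0.
  by rewrite ltNge; apply/negP => b0;
    have := mulr_le0_ge0 a0 b0; rewrite leNgt ab0.
by rewrite nmulr_rgt0// (lt_trans Hb).
Qed.

Let H_neq0 : H != 0.
Proof. by apply: contraTneq bH => ->; rewrite mulr0 ltxx. Qed.

(** A convex combination of the positive numbers [b * H] and [b ^+ 2]. The factor [b] covers
    positive and negative intervals at once. *)
Let den_gt0 t : 0 <= t <= 1 -> 0 < b * den t.
Proof.
move=> /andP[t0 t1].
have b2 : 0 < b ^+ 2 by rewrite exprn_even_gt0.
have -> : b * den t = t * (b * H) + (1 - t) * b ^+ 2 by rewrite /den; ring.
have [->|tN0] := eqVneq t 0; first by rewrite mul0r add0r subr0 mul1r.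
rewrite ltr_pwDl//; first by rewrite mulr_gt0// lt_neqAle eq_sym tN0.
by rewrite mulr_ge0 ?subr_ge0// ltW.
Qed.

Let den_neq0 t : 0 <= t <= 1 -> den t != 0.
Proof. by move=> /den_gt0; apply: contraTneq => ->; rewrite mulr0 ltxx. Qed.

(** Turns the derivative [b * H * (b - H) / den t ^+ 2] of [Upath] into a constant multiple of its
    square. *)
Let H_eq : (b - a) / (2 * a * b) * (b * H) = b - H.
Proof.
have s0 : a + b != 0.
  by apply: contraTneq bH => s0; rewrite /H /harm s0 invr0 !mulr0 ltxx.
by rewrite /H /harm; field; rewrite a_neq0 b_neq0 s0.
Qed.

Let w t := (b - a) / (2 * a * b) * Upath a b t ^+ 2.

Let is_derive_Upath (t : R) : 0 <= t <= 1 -> is_derive t 1 (Upath a b) (w t).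
Proof.
move=> t01; have dt := den_neq0 t t01.
have ddt : is_derive t 1 den (H - b).
  have -> : den = (fun x => x * (H - b)) + cst b.
    by apply/funext => x; rewrite /den -[RHS]/(x * (H - b) + b); ring.
  apply: is_derive_eq.
  by rewrite scaler0 add0r addr0 [_ *: _]mulr1.
have -> : Upath a b = (b * H) *: (fun t => (den t)^-1) by [].
apply: is_derive_eq.
rewrite -[LHS]/((b * H) * (- den t ^- 2 * (H - b))) /w.
rewrite -[Upath a b t]/(b * H / den t) exprMn exprVn.
rewrite [_ / _ * _]mulrA expr2 [_ / _ * (_ * _)]mulrA H_eq; ring.
Qed.

Lemma Upath0 : Upath a b 0 = H.
Proof.
by rewrite /Upath mul0r add0r subr0 mul1r -/H [b * H]mulrC mulfK.
Qed.

Lemma Upath1 : Upath a b 1 = b.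
Proof. by rewrite /Upath mul1r subrr mul0r addr0 mulfK. Qed.

Lemma Upath_substitution (g : R -> R) :
  mu.-integrable `[H, b] (EFin \o g) ->
  mu.-integrable `[0, 1] (fun t => (g (Upath a b t) * Upath a b t ^+ 2)%:E) /\
  \int[mu]_(t in `[0, 1]) (g (Upath a b t) * Upath a b t ^+ 2) =
  2 * a * b / (b - a) * \int[mu]_(x in `[H, b]) g x.
Proof.
move=> ig.
have Ucont : {within `[0, 1], continuous (Upath a b)}.
  apply: derivable_within_continuous => t; rewrite in_itv/= => /is_derive_Upath.
  by case.
have Uincr : {in `[0, 1] &, {homo Upath a b : x y / x < y}}.
  move=> x y; rewrite !in_itv/= => x01 y01 xy.
  rewrite -subr_gt0 -[Upath a b x]/(b * H / den x).
  rewrite -[Upath a b y]/(b * H / den y).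
  have -> : b * H / den y - b * H / den x =
      b * H * ((y - x) * (b - H)) / (den x * den y).
    have dx := den_neq0 x x01; have dy := den_neq0 y y01.
    have -> : (y - x) * (b - H) = den x - den y by rewrite /den; ring.
    by field; rewrite dx dy.
  have dxy : 0 < den x * den y.
    have := mulr_gt0 (den_gt0 x x01) (den_gt0 y y01).
    by rewrite mulrACA pmulr_rgt0// -expr2 exprn_even_gt0.
  have /andP[_ Hb] := harm_between a b ab ab0.
  apply: divr_gt0 => //; apply: mulr_gt0 => //.
  by apply: mulr_gt0; rewrite subr_gt0.
pose c := (b - a) / (2 * a * b).
have c0 : 0 < c by rewrite divr_gt0 ?subr_gt0// -mulrA mulr_gt0.
have w0 t : 0 <= t <= 1 -> 0 <= w t.
  by move=> _; rewrite /w mulr_ge0 ?sqr_ge0// ltW.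
have iw : mu.-integrable `[0, 1] (EFin \o w).
  apply: continuous_compact_integrable; first exact: segment_compact.
  apply: (@within_continuousM _ _ (cst c) (Upath a b * Upath a b)).
    by apply: continuous_subspaceT => x; exact: cvg_cst.
  exact: within_continuousM.
have dU (t : R) : 0 < t < 1 -> is_derive t 1 (Upath a b) (w t).
  by move=> /andP[t0 t1]; apply: is_derive_Upath; rewrite !ltW.
have := @integrable_increasing_substitution _ (Upath a b) w 0 1 ler01
  Uincr Ucont dU w0 iw g.
rewrite Upath0 Upath1 => /(_ ig)[igw Egw].
(* The substitution weight is [c] times the square of the path, so dividing by [c] produces the
   factor [2 * a * b / (b - a)]. *)
have cK t : g (Upath a b t) * Upath a b t ^+ 2 = c^-1 * (g (Upath a b t) * w t).
  by rewrite /w -/c [RHS]mulrCA mulKf// gt_eqF.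
split.
  by apply: eq_integrable (integrableZl _ c^-1 igw) => // t _; rewrite cK.
under eq_Rintegral do rewrite cK.
rewrite RintegralZl// -[2 * a * b / _]invf_div -/c; congr (_ * _).
by rewrite /Rintegral Egw.
Qed.
End Upath_substitution.

Lemma Lpath_substitution (a b : R) (g : R -> R) : a < b -> 0 < a * b ->
  mu.-integrable `[a, harm a b] (EFin \o g) ->
  mu.-integrable `[0, 1] (fun t => (g (Lpath a b t) * Lpath a b t ^+ 2)%:E) /\
  \int[mu]_(t in `[0, 1]) (g (Lpath a b t) * Lpath a b t ^+ 2) =
  2 * a * b / (b - a) * \int[mu]_(x in `[a, harm a b]) g x.
Proof.
move=> ab ab0 ig.
have ab' : - b < - a by rewrite ltrN2.
have ab0' : 0 < - b * - a by rewrite mulrNN mulrC.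
have E : harm (- b) (- a) = - harm a b.
  by rewrite /harm -opprD invrN [b + a]addrC !mulrN !mulNr opprK; ring.
have [ig' Eg] := integrable_reflect _ _ _ ig.
have := Upath_substitution _ _ ab' ab0' (g \o -%R).
rewrite E => /(_ ig')[iU EU].
have L2 t : g (Lpath a b t) * Lpath a b t ^+ 2 =
    (g \o -%R) (Upath (- b) (- a) t) * Upath (- b) (- a) t ^+ 2.
  by rewrite Lpath_Upath sqrrN.
split; first by apply: eq_integrable iU => // t _; rewrite L2.
under eq_Rintegral do rewrite L2.
rewrite EU [in RHS]/Rintegral Eg; congr (_ / _ * _); ring.
Qed.
End harmonic_paths.

(** * Rules for integrals over segments and the final identity *)

Lemma integrable_continuousM (R : realType) (F g : R -> R) (a b : R) :
  {within `[a, b], continuous F} ->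
  lebesgue_measure.-integrable `[a, b] (EFin \o g) ->
  lebesgue_measure.-integrable `[a, b] (fun x => (F x * g x)%:E).
Proof.
move=> cF ig; apply: (integrableMr _ _ _ ig) => //.
  exact: subspace_continuous_measurable_fun.
have /compact_bounded[M [_ FM]] :=
  continuous_compact cF (@segment_compact _ a b).
by exists M; split; rewrite ?num_real // => ? ? ? ?; exact: FM.
Qed.

Lemma Rintegral_itv_split (R : realType) (g : R -> R) (a c b : R) :
  a <= c <= b ->
  lebesgue_measure.-integrable `[a, b] (EFin \o g) ->
  \int[lebesgue_measure]_(x in `[a, b]) g x =
  \int[lebesgue_measure]_(x in `[a, c]) g x +
  \int[lebesgue_measure]_(x in `[c, b]) g x.
Proof.
move=> /andP[ac cb] ig.
rewrite -[X in _ + X]Rintegral_itv_obnd_cbnd; last first.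
  by apply: integrableS ig => //; apply: subset_itv; rewrite bnd_simp.
rewrite -Rintegral_setU//.
- by rewrite -itv_bndbnd_setU// bnd_simp.
- by rewrite -itv_bndbnd_setU// bnd_simp.
- apply/eqP; rewrite -subset0 => x [] /=; rewrite !in_itv/=; lra.
Qed.

Lemma RintegralZB (R : realType) (u v : R -> R) (a b c d : R) :
  lebesgue_measure.-integrable `[a, b] (EFin \o u) ->
  lebesgue_measure.-integrable `[a, b] (EFin \o v) ->
  \int[lebesgue_measure]_(x in `[a, b]) (c * u x - d * v x) =
  c * \int[lebesgue_measure]_(x in `[a, b]) u x
  - d * \int[lebesgue_measure]_(x in `[a, b]) v x.
Proof.
move=> iu iv.
rewrite -(RintegralZl c _ iu)// -(RintegralZl d _ iv)//.
have icu := integrableZl _ c iu.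
have idv := integrableZl _ d iv.
by rewrite -(RintegralB _ (icu _) (idv _)).
Qed.

Theorem lemma2 (R : realType) (I : set R) (f h : R -> R) (a b : R)
  (I_itv : is_interval I) (I_neq0 : ~ I 0)
  (f_diff : forall x, I° x -> derivable f x 1)
  (Ia : I a) (Ib : I b) (le_ab : a <= b)
  (h_ge0 : forall x, x \in `[a, b] -> 0 <= h x)
  (h_diff : forall x, x \in `[a, b] -> derivable_within `[a, b] h x)
  (f'_int : lebesgue_measure.-integrable `[a, b] (EFin \o derive1 f))
  (* f' being a function on [a, b] presupposes that f does not jump at a or b
     when these are endpoints of I *)
  (f_cont : {within `[a, b], continuous f})
  (* the integral of f h' in the identity exists *)
  (fh'_int : lebesgue_measure.-integrable `[a, b]
     (fun x => (f x * derive_within `[a, b] h x)%:E)) :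
  (h b - 2 * h a) * (f a / 2) + h b * (f b / 2)
    - \int[lebesgue_measure]_(x in `[a, b])
        (f x * derive_within `[a, b] h x)
  = (b - a) / (4 * a * b) *
    (\int[lebesgue_measure]_(t in `[0, 1])
        ((2 * h (Lpath a b t) - h b) * derive1 f (Lpath a b t) * Lpath a b t ^+ 2)
     + \int[lebesgue_measure]_(t in `[0, 1])
        ((2 * h (Upath a b t) - h b) * derive1 f (Upath a b t) * Upath a b t ^+ 2)).
Proof.
set mu := lebesgue_measure.
(* For [a = b] the integral on the left is over a point, its boundary terms cancel, and the factor
   [b - a] annihilates the right. *)
have [<-|neq_ab] := eqVneq a b.
  rewrite subrr !mul0r set_itv1 Rintegral_set1; lra.
have ab : a < b by rewrite lt_neqAle neq_ab.
(* Endpoints of opposite sign, or a zero endpoint, would put 0 into the interval [I]. *)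
have ab0 : 0 < a * b.
  have [a0|a0] := ltP 0 a; first by rewrite mulr_gt0// (lt_trans a0).
  have [b0|b0] := ltP b 0.
    by rewrite nmulr_rgt0// (lt_trans ab).
  by case: I_neq0; apply: (I_itv _ _ Ia Ib); rewrite a0.
have sub_int x : a < x < b -> (`[a, b]%classic : set R)° x /\ I° x.
  move=> xab.
  have oo : nbhs x (`]a, b[%classic : set R).
    by apply: open_nbhs_nbhs; split; [exact: interval_open|rewrite /= in_itv].
  split; apply: filterS oo => y /=; rewrite !in_itv/= => /andP[ay yb].
    by rewrite !ltW.
  by apply: (I_itv _ _ Ia Ib); rewrite !ltW.
have df (x : R) : a < x < b -> is_derive x 1 f (derive1 f x).
  by move=> /sub_int[_ /f_diff] /derivableP; rewrite derive1E.
pose h' := derive_within `[a, b] h.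
have dh (x : R) : a < x < b -> is_derive x 1 h (h' x).
  move=> xab; have [xi _] := sub_int x xab.
  apply: is_derive_within => //; apply: h_diff.
  by case/andP : xab => ? ?; rewrite in_itv/= !ltW.
have h_cont : {within `[a, b], continuous h}.
  by apply: derivable_within_continuous_within => x xab; exact: h_diff.
have ihf' := @integrable_continuousM _ h (derive1 f) a b h_cont f'_int.
have parts : \int[mu]_(x in `[a, b]) (h x * derive1 f x) =
    h b * f b - h a * f a - \int[mu]_(x in `[a, b]) (f x * h' x).
  rewrite (@integrable_by_parts _ h f h' (derive1 f) a b)//.
    by congr (_ - _); apply: eq_Rintegral => x _; rewrite mulrC.
  by apply: eq_integrable fh'_int => // x _; rewrite mulrC.
have f_int : \int[mu]_(x in `[a, b]) derive1 f x = f b - f a.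
  by rewrite /Rintegral (_ : (\int[mu]_(x in `[a, b]) _)%E = (f b - f a)%:E)//;
    apply: integrable_FTC2.
(* Both path integrals have this integrand after substitution: [Lpath] covers the segment from [a]
   to the harmonic mean, [Upath] the one from there to [b]. *)
pose G x := (2 * h x - h b) * derive1 f x.
have GE x : G x = 2 * (h x * derive1 f x) - h b * derive1 f x.
  by rewrite /G; ring.
have iG2 := integrableZl _ 2 ihf'.
have iGb := integrableZl _ (h b) f'_int.
have iG : mu.-integrable `[a, b] (EFin \o G).
  apply: eq_integrable (integrableB _ (iG2 _) (iGb _)) => // x _.
  by rewrite /= GE.
have intG : \int[mu]_(x in `[a, b]) G x =
    2 * \int[mu]_(x in `[a, b]) (h x * derive1 f x)
    - h b * \int[mu]_(x in `[a, b]) derive1 f x.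
  under eq_Rintegral do rewrite GE.
  exact: RintegralZB.
have /andP[aH Hb] := harm_between a b ab ab0.
have [|_ ->] := @Lpath_substitution _ a b G ab ab0.
  apply: integrableS iG => //; apply: subset_itvl; rewrite bnd_simp; exact: ltW.
have [|_ ->] := @Upath_substitution _ a b ab ab0 G.
  apply: integrableS iG => //; apply: subset_itvr; rewrite bnd_simp; exact: ltW.
rewrite -mulrDr -(@Rintegral_itv_split _ G a (harm a b) b)
  ?(ltW aH) ?(ltW Hb)//.
rewrite intG parts f_int -/h'.
have a0 : a != 0 by apply: contraTneq ab0 => ->; rewrite mul0r ltxx.
have b0 : b != 0 by apply: contraTneq ab0 => ->; rewrite mulr0 ltxx.
have ba : b - a != 0 by rewrite subr_eq0 gt_eqF.
(* The prefactor [(b - a) / (4 * a * b)] times [2 * a * b / (b - a)] leaves [1 / 2]. *)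
by field; rewrite a0 b0 ba.
Qed.
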